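(* Let $B=[b_1,\ldots,b_n]\in\mathbb{C}[x_1,\ldots,x_m]^n$, let $\mathbf{z}_1,\ldots,\mathbf{z}_k\in\mathbb{C}^m$, and let $$C_i=\{\mathbf{z}_i+\vec{\delta}_{i,1}\varepsilon,\ldots,\mathbf{z}_i+\vec{\delta}_{i,n_i}\varepsilon\},\qquad i=1,\ldots,k,$$ be clusters with $\sum_{i=1}^kn_i=n$, where $\varepsilon$ is a parameter and $\vec{\delta}_{i,j}=[\delta_{i,j,1},\ldots,\delta_{i,j,m}]\in\mathbb{C}^m$ with $|\delta_{i,j,r}|<1$ for all $i,j,r$. Let $R$ be the matrix of traces associated to $C_1\cup\cdots\cup C_k$ and $B$. Let $P$ be the (row) permutation matrix produced by $k$ steps of Gaussian elimination with complete pivoting on $R$, where $B$ is ordered so that the column permutation is the identity, and assume that $P\,R|_{\varepsilon=0}$ has rank $k$ and is regular. Let $\sigma_1\geq\cdots\geq\sigma_n$ be the singular values of $R$, and let $\mathbf{b}'$ be such that $$\mathbf{b}'\geq\max_{l,i,r}\left\{\left|\frac{\partial b_l}{\partial x_r}(\mathbf{z}_i)\right|\right\}$$ (maximum over $l=1,\ldots,n$, $i=1,\ldots,k$, $r=1,\ldots,m$). Then $$\sigma_{k+1}=\Omega\varepsilon^2+\mathrm{h.o.t.}(\varepsilon),$$ where $$\Omega\leq4(n-k)^2(k+1)^2m^2\sqrt{\frac{2n+2nk-k^2-k}{2}}\,(\mathbf{b}')^2.$$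
   Context: The matrix of traces associated to $C_1\cup\cdots\cup C_k$ and $B$ is the $n\times n$ symmetric matrix, with entries polynomial in $\varepsilon$, $$R=\left[\sum_{s=1}^k\sum_{t=1}^{n_s}(b_ib_j)(\mathbf{z}_s+\vec{\delta}_{s,t}\varepsilon)\right]_{i,j=1}^n.$$ Its singular values are considered as functions of $\varepsilon$ for small $\varepsilon>0$; $\mathrm{h.o.t.}(\varepsilon)$ denotes higher order terms in $\varepsilon$ as $\varepsilon\to0$. Regular Gaussian elimination is the version of Gaussian (row) elimination in which at the $i$-th step the entry at position $(i,i)$ is always the pivot. A matrix $M$ is regular if, for $r:=\mathrm{rank}(M)$, the first $r$ steps of regular Gaussian elimination on $M$ do not encounter zero pivots. Gaussian elimination with complete pivoting (GECP): at step $i$, rows and columns of index $\geq i$ are permuted so that the $(i,i)$ entry of the current matrix has maximal absolute value among the entries with both indices $\geq i$; it is then used as pivot. For $R$ depending on $\varepsilon$, absolute values are compared for sufficiently small $\varepsilon>0$. The permutation matrices $P,Q$ it produces are such that regular Gaussian elimination on $P\,R\,Q$ works as GECP; by renaming the elements of $B$ one assumes $Q=\mathrm{id}$. *)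

(* Defs.v *)
From HB Require Import structures.
From mathcomp Require Import all_boot all_order all_fingroup all_algebra.
From mathcomp Require Import complex mpoly.
From mathcomp Require Import all_classical all_reals all_analysis.

Set Implicit Arguments.
Unset Strict Implicit.
Unset Printing Implicit Defensive.

Import Order.TTheory GRing.Theory Num.Theory.
Import numFieldNormedType.Exports.

Local Open Scope ring_scope.
Local Open Scope complex_scope.
Local Open Scope sesquilinear_scope.
Local Open Scope classical_set_scope.

(** The value of a polynomial at a point of C^m given as a row vector. *)
Definition eval_at (R : realType) (m : nat) (x : 'rV[R[i]]_m)
    (p : {mpoly R[i][m]}) : R[i] :=
  p.@[fun r : 'I_m => x 0 r].

(** The clusters are given by their centers [z s], their sizes [ns s] and the
    directions [delta s t]; the result is the matrix of traces at [eps]. *)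
Definition trace_mx (R : realType) (m n k : nat)
    (B : 'I_n -> {mpoly R[i][m]}) (z : 'I_k -> 'rV[R[i]]_m)
    (ns : 'I_k -> nat) (delta : forall s : 'I_k, 'I_(ns s) -> 'rV[R[i]]_m)
    (eps : R) : 'M[R[i]]_n :=
  \matrix_(i, j) \sum_(s < k) \sum_(t < ns s)
    eval_at (z s + eps%:C *: delta s t) (B i * B j).

(** One step of row elimination with the entry at [(i, i)] as the pivot. *)
Definition elim_step (F : fieldType) (n : nat) (i : 'I_n) (A : 'M[F]_n) :
    'M[F]_n :=
  \matrix_(p, q) (if (i < p)%N then A p q - A p i / A i i * A i q else A p q).

Definition regular_elim (F : fieldType) (n : nat) (l : nat) (A : 'M[F]_n) :
    'M[F]_n :=
  foldl (fun U i => elim_step i U) A (take l (enum 'I_n)).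

(** Steps are numbered from 0: the matrix in which the pivot [(i, i)] is read
    is the one obtained after [i] steps. *)
Definition regular_mx (F : fieldType) (n : nat) (A : 'M[F]_n) : Prop :=
  forall i : 'I_n, (i < \rank A)%N -> regular_elim i A i i != 0.

Definition complete_pivot (C : numFieldType) (n : nat) (i : 'I_n)
    (A : 'M[C]_n) : Prop :=
  A i i != 0 /\
  forall p q : 'I_n, (i <= p)%N -> (i <= q)%N -> `|A p q| <= `|A i i|.

(** [gecp A l P Q U]: a possible outcome of [l] steps of Gaussian elimination
    with complete pivoting on the matrix [A eps], with [eps] small and positive;
    [P] and [Q] are the accumulated row and column permutation matrices and [U]
    is the current matrix. This is a relation because several entries may have
    the maximal absolute value. *)
Inductive gecp (R : realType) (n : nat) (A : R -> 'M[R[i]]_n) :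
    nat -> 'M[R[i]]_n -> 'M[R[i]]_n -> (R -> 'M[R[i]]_n) -> Prop :=
| gecp_init : gecp A 0%N 1%:M 1%:M A
| gecp_step (i : 'I_n) (P Q : 'M[R[i]]_n) (U : R -> 'M[R[i]]_n) (s t : 'S_n) :
    gecp A i P Q U ->
    (forall j : 'I_n, (j < i)%N -> s j = j) ->
    (forall j : 'I_n, (j < i)%N -> t j = j) ->
    (\forall eps \near 0^'+,
       complete_pivot i (perm_mx s *m U eps *m perm_mx t)) ->
    gecp A i.+1 (perm_mx s *m P) (Q *m perm_mx t)
      (fun eps => elim_step i (perm_mx s *m U eps *m perm_mx t)).

Definition gecp_perms (R : realType) (n : nat) (A : R -> 'M[R[i]]_n) (l : nat)
    (P Q : 'M[R[i]]_n) : Prop :=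
  exists U : R -> 'M[R[i]]_n, gecp A l P Q U.

(** The matrix [A ^t* *m A] is normal, so that [spectral_diag] lists its
    eigenvalues with multiplicity; they are real and nonnegative. *)
Definition singular_values (R : realType) (n : nat) (A : 'M[R[i]]_n) : seq R :=
  sort (fun x y : R => y <= x)
    [seq Num.sqrt (complex.Re (spectral_diag (A ^t* *m A) 0 i)) |
       i <- enum 'I_n].

(** [singular_value A j] is the [j]-th largest singular value, with [j] counted
    from 0; it is 0 for [n <= j]. *)
Definition singular_value (R : realType) (n : nat) (A : 'M[R[i]]_n)
    (j : nat) : R :=
  nth 0 (singular_values A) j.

(* Main.v *)
(** Averaging the rows of each cluster writes the matrix of traces exactly as
    [R = V^T D V + eps^2 G], where the rows of [V] are the cluster means of
    [B], [D] is the diagonal matrix of the cluster sizes and [G] is the sum of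
    the Gram matrices [Z_s^T Z_s] of the centred difference quotients of [B].
    In a unitary basis in which [V] at [eps = 0] is [T 0], [T] invertible, the
    off-diagonal blocks of [R] are [O(eps)] and the Schur complement of the
    leading [k * k] block is [eps^2 S] with [S] converging to the last diagonal
    block [S0] of [G]. Courant-Fischer bounds [sigma_(k+1)] above and below by
    [eps^2] times the operator norm of [S], up to a factor that tends to 1, so
    [Omega] is the operator norm of [S0]. It is at most
    [sum_s |Z_s|^2 <= 4 n^2 m^2 b'^2] in Frobenius norm, and
    [n <= (n - k) (k + 1)] concludes. *)

Require Import Defs.
From HB Require Import structures.
From mathcomp Require Import all_boot all_order all_fingroup all_algebra.
From mathcomp Require Import complex mpoly.
From mathcomp Require Import all_classical all_reals all_analysis.
From mathcomp Require Import ring lra zify.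

Set Implicit Arguments.
Unset Strict Implicit.
Unset Printing Implicit Defensive.

Import Order.TTheory GRing.Theory Num.Theory.
Import numFieldNormedType.Exports.
Import ComplexField.Normc.

Local Open Scope ring_scope.
Local Open Scope complex_scope.
Local Open Scope sesquilinear_scope.
Local Open Scope classical_set_scope.

(** * Frobenius norm *)

(** By Lagrange's identity, the double sum of the squares of [a i * b j - a j * b i] is twice the
    right-hand side minus the left-hand side. *)
Lemma sqr_sum_mul_le (R : realDomainType) (I : finType) (a b : I -> R) :
  (\sum_i a i * b i) ^+ 2 <= (\sum_i a i ^+ 2) * (\sum_i b i ^+ 2).
Proof.
have : 0 <= \sum_i \sum_j (a i * b j - a j * b i) ^+ 2.
  by apply: sumr_ge0 => i _; apply: sumr_ge0 => j _; exact: sqr_ge0.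
rewrite (eq_bigr (fun i => \sum_j (a i ^+ 2 * b j ^+ 2 + b i ^+ 2 * a j ^+ 2
    - 2 * ((a i * b i) * (a j * b j))))); last first.
  by move=> i _; apply: eq_bigr => j _; ring.
under eq_bigr => i _ do rewrite sumrB big_split /= -!mulr_sumr.
rewrite sumrB big_split /= -!mulr_suml -mulr_sumr -mulr_suml.
set X := \sum_i a i ^+ 2; set Y := \sum_i b i ^+ 2; set Z := \sum_i _ * _.
move=> h; nra.
Qed.

Section Frobenius.
Variable R : rcfType.
Local Notation C := R[i].

Definition fro (p q : nat) (A : 'M[C]_(p, q)) : R :=
  Num.sqrt (\sum_i \sum_j normc (A i j) ^+ 2).

Lemma normr_normc (x : C) : `|x| = (normc x)%:C.
Proof. by []. Qed.

Lemma normc_ge0 (x : C) : 0 <= normc x.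
Proof. by rewrite -lecR -normr_normc; exact: normr_ge0. Qed.

Lemma normc_sum (I : finType) (f : I -> C) :
  normc (\sum_i f i) <= \sum_i normc (f i).
Proof.
rewrite -lecR -normr_normc rmorph_sum /=.
exact: ler_norm_sum.
Qed.

Lemma normc_conj (x : C) : normc (Num.conj x) = normc x.
Proof. by apply: (@complexI R); rewrite -!normr_normc norm_conjC. Qed.

Lemma fro_ge0 p q (A : 'M[C]_(p, q)) : 0 <= fro A.
Proof. exact: sqrtr_ge0. Qed.

Lemma fro_sqr p q (A : 'M[C]_(p, q)) :
  fro A ^+ 2 = \sum_i \sum_j normc (A i j) ^+ 2.
Proof.
rewrite sqr_sqrtr // sumr_ge0 // => i _; apply: sumr_ge0 => j _; exact: sqr_ge0.
Qed.

Lemma fro_le p q p' q' (A : 'M[C]_(p, q)) (B : 'M[C]_(p', q')) :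
  \sum_i \sum_j normc (A i j) ^+ 2 <= \sum_i \sum_j normc (B i j) ^+ 2 ->
  fro A <= fro B.
Proof. exact: ler_wsqrtr. Qed.

(** As a trace, the norm turns unitary invariance into a matrix identity. *)
Lemma fro_trace p q (A : 'M[C]_(p, q)) : (fro A ^+ 2)%:C = \tr (A *m A ^t*).
Proof.
rewrite fro_sqr rmorph_sum; apply: eq_bigr => i _.
rewrite rmorph_sum mxE; apply: eq_bigr => j _.
by rewrite !mxE -normCK normr_normc rmorphXn.
Qed.

Lemma fro_eq0 p q (A : 'M[C]_(p, q)) : fro A = 0 -> A = 0.
Proof.
move=> A0; have := fro_sqr A; rewrite A0 expr0n /= => /esym/eqP.
rewrite psumr_eq0 => [/allP h|i _]; last by apply: sumr_ge0 => j _; apply: sqr_ge0.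
apply/matrixP => i j; have := h i (mem_index_enum i).
rewrite /= psumr_eq0 => [/allP h'|s _]; last exact: sqr_ge0.
have := h' j (mem_index_enum j); rewrite /= sqrf_eq0 => /eqP /eq0_normc.
by rewrite mxE.
Qed.

Lemma fro_gt0 p q (A : 'M[C]_(p, q)) : A != 0 -> 0 < fro A.
Proof.
move=> A0; rewrite lt_neqAle fro_ge0 andbT; apply: contraNneq A0 => h.
by apply/eqP/fro_eq0.
Qed.

Lemma fro_tr p q (A : 'M[C]_(p, q)) : fro A^T = fro A.
Proof.
rewrite /fro exchange_big; congr Num.sqrt.
by apply: eq_bigr => i _; apply: eq_bigr => j _; rewrite mxE.
Qed.

Lemma fro_conj p q (A : 'M[C]_(p, q)) : fro (map_mx Num.conj A) = fro A.
Proof.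
congr Num.sqrt; apply: eq_bigr => i _; apply: eq_bigr => j _.
by rewrite mxE normc_conj.
Qed.

Lemma froZ p q a (A : 'M[C]_(p, q)) : fro (a *: A) = normc a * fro A.
Proof.
apply/eqP; rewrite -(eqrXn2 (ltn0Sn 1)) ?fro_ge0 ?mulr_ge0 ?fro_ge0 ?normc_ge0 //.
rewrite exprMn !fro_sqr mulr_sumr; apply/eqP/eq_bigr => i _.
by rewrite mulr_sumr; apply: eq_bigr => j _; rewrite mxE normcM exprMn.
Qed.

Lemma froN p q (A : 'M[C]_(p, q)) : fro (- A) = fro A.
Proof.
congr Num.sqrt; apply: eq_bigr => i _; apply: eq_bigr => j _.
by rewrite mxE normcN.
Qed.

Lemma fro0 p q : fro (0 : 'M[C]_(p, q)) = 0.
Proof. by rewrite -(scale0r 0) froZ normc0 mul0r. Qed.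

(** Minkowski's inequality: after squaring, Cauchy-Schwarz over pairs of indices bounds the cross
    terms. *)
Lemma froD p q (A B : 'M[C]_(p, q)) : fro (A + B) <= fro A + fro B.
Proof.
rewrite -(@ler_pXn2r _ 2) ?nnegrE ?addr_ge0 ?fro_ge0 //.
have cs := sqr_sum_mul_le (fun x : 'I_p * 'I_q => normc (A x.1 x.2))
  (fun x => normc (B x.1 x.2)).
have H (X : 'M[C]_(p, q)) : \sum_(x : 'I_p * 'I_q) normc (X x.1 x.2) ^+ 2 = fro X ^+ 2.
  by rewrite fro_sqr pair_bigA.
rewrite !H -exprMn in cs.
have {}cs : \sum_(x : 'I_p * 'I_q) normc (A x.1 x.2) * normc (B x.1 x.2) <= fro A * fro B.
  rewrite -(@ler_pXn2r _ 2) ?nnegrE ?mulr_ge0 ?fro_ge0 //.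
  by apply: sumr_ge0 => i _; rewrite mulr_ge0 ?normc_ge0.
rewrite -H sqrrD -!H.
apply: (@le_trans _ _ (\sum_(x : 'I_p * 'I_q) (normc (A x.1 x.2) + normc (B x.1 x.2)) ^+ 2)).
  apply: ler_sum => x _; rewrite ler_pXn2r ?nnegrE ?addr_ge0 ?normc_ge0 // mxE.
  exact: le_normcD.
under eq_bigr => x _ do rewrite sqrrD.
by rewrite !big_split /= lerD2r lerD2l mulr2n lerD.
Qed.

Lemma froB p q (A B : 'M[C]_(p, q)) : fro (A - B) <= fro A + fro B.
Proof. by rewrite -(froN B) froD. Qed.

Lemma fro_sum (I : finType) p q (A : I -> 'M[C]_(p, q)) :
  fro (\sum_i A i) <= \sum_i fro (A i).
Proof.
elim/big_ind2: _ => [|x X y Y hx hy|//]; first by rewrite fro0.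
by apply: le_trans (froD _ _) _; apply: lerD.
Qed.

(** Cauchy-Schwarz is applied to each row of [A] against each column of [B]. *)
Lemma froM p q r (A : 'M[C]_(p, q)) (B : 'M[C]_(q, r)) :
  fro (A *m B) <= fro A * fro B.
Proof.
rewrite -(@ler_pXn2r _ 2) ?nnegrE ?mulr_ge0 ?fro_ge0 // exprMn.
rewrite -(fro_tr B) !fro_sqr mulr_suml; apply: ler_sum => i _.
rewrite mulr_sumr; apply: ler_sum => j _.
under [X in _ <= _ * X]eq_bigr => s _ do rewrite mxE.
apply: le_trans (sqr_sum_mul_le _ _).
rewrite ler_pXn2r ?nnegrE ?normc_ge0 ?sumr_ge0 //; last first.
  by move=> s _; rewrite mulr_ge0 ?normc_ge0.
rewrite mxE; apply: le_trans (normc_sum _) _.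
by apply: ler_sum => s _; rewrite normcM.
Qed.

Lemma fro_unitary p q (A : 'M[C]_(p, q)) (U : 'M[C]_q) :
  U \is unitarymx -> fro (A *m U) = fro A.
Proof.
move=> uU; apply/eqP; rewrite -(eqrXn2 (ltn0Sn 1)) ?fro_ge0 //.
apply/eqP/(@complexI R); rewrite !fro_trace trmx_mul map_mxM mulmxA.
by rewrite mulmxtVK.
Qed.

Lemma fro_row_mx p q r (A : 'M[C]_(p, q)) (B : 'M[C]_(p, r)) :
  fro (row_mx A B) ^+ 2 = fro A ^+ 2 + fro B ^+ 2.
Proof.
rewrite !fro_sqr -big_split; apply: eq_bigr => i _.
rewrite big_split_ord; congr (_ + _); apply: eq_bigr => j _.
  by rewrite row_mxEl.
by rewrite row_mxEr.
Qed.

Lemma fro_row_mx_ler p q r (A : 'M[C]_(p, q)) (B : 'M[C]_(p, r)) :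
  fro B <= fro (row_mx A B).
Proof.
rewrite -(@ler_pXn2r _ 2) ?nnegrE ?fro_ge0 // fro_row_mx.
by rewrite lerDr sqr_ge0.
Qed.

Lemma fro_row_mx_lel p q r (A : 'M[C]_(p, q)) (B : 'M[C]_(p, r)) :
  fro A <= fro (row_mx A B).
Proof.
rewrite -(@ler_pXn2r _ 2) ?nnegrE ?fro_ge0 // fro_row_mx.
by rewrite lerDl sqr_ge0.
Qed.

Lemma fro_row_mx_leD p q r (A : 'M[C]_(p, q)) (B : 'M[C]_(p, r)) :
  fro (row_mx A B) <= fro A + fro B.
Proof.
rewrite -(@ler_pXn2r _ 2) ?nnegrE ?addr_ge0 ?fro_ge0 // fro_row_mx.
rewrite sqrrD addrAC lerDl mulrn_wge0 // mulr_ge0 ?fro_ge0 //.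
Qed.

End Frobenius.

(** * Courant-Fischer inequalities *)

(** Dimension count: the dimensions of the row space of [X] and of the left kernel of [D] add up to
    more than [n]. *)
Lemma sub_kernel_neq0 (F : fieldType) p n q (X : 'M[F]_(p, n)) (D : 'M[F]_(n, q)) :
  (\rank D < \rank X)%N ->
  exists u : 'rV[F]_n, [/\ u != 0, (u <= X)%MS & u *m D = 0].
Proof.
move=> lt; have : (X :&: kermx D)%MS != 0.
  rewrite -mxrank_eq0 -lt0n; have := mxrank_sum_cap X (kermx D).
  have := rank_leq_col (X + kermx D)%MS; have := rank_leq_row D.
  rewrite mxrank_ker; lia.
move=> h; exists (nz_row (X :&: kermx D)%MS); split.
- by rewrite nz_row_eq0.
- exact: submx_trans (nz_row_sub _) (capmxSl _ _).
- by apply/sub_kermxP; exact: submx_trans (nz_row_sub _) (capmxSr _ _).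
Qed.

Section SingularValues.
Variable R : realType.
Local Notation C := R[i].

Lemma gram_spectral n (A : 'M[C]_n) (Q := spectralmx (A ^t* *m A))
    (d := spectral_diag (A ^t* *m A)) (v : 'rV[C]_n) :
  (fro (v *m A ^t*) ^+ 2)%:C =
    \sum_i d 0 i * (normc ((v *m Q ^t*) 0 i) ^+ 2)%:C.
Proof.
have uQ : Q \is unitarymx by apply: spectral_unitarymx.
have nG : A ^t* *m A \is normalmx.
  by apply/normalmxP; rewrite trmx_mul map_mxM trmxCK.
have /orthomx_spectralP := nG; rewrite -/Q -/d => eG.
rewrite fro_trace trmx_mul map_mxM trmxCK.
have -> : v *m A ^t* *m (A *m v ^t*) = (v *m Q ^t*) *m diag_mx d *m (v *m Q ^t*) ^t*.
  by rewrite trmx_mul map_mxM trmxCK !mulmxA -(mulmxA v) eG invmx_unitary // !mulmxA.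
rewrite trace_mx11 mxE; apply: eq_bigr => i _.
rewrite mul_mx_diag !mxE -mulrA mulrCA -normCK normr_normc rmorphXn //.
Qed.

(** Evaluating [gram_spectral] at the [i]-th eigenvector shows that the eigenvalue is a squared
    norm, so taking the real part and the square root loses nothing. *)
Lemma spectral_diag_gram n (A : 'M[C]_n) (i : 'I_n) :
  spectral_diag (A ^t* *m A) 0 i =
    (Num.sqrt (complex.Re (spectral_diag (A ^t* *m A) 0 i)) ^+ 2)%:C.
Proof.
set Q := spectralmx (A ^t* *m A); set d := spectral_diag (A ^t* *m A).
have uQ : Q \is unitarymx by apply: spectral_unitarymx.
have := gram_spectral A (row i Q); rewrite -/Q -/d.
rewrite -(row_mul i Q (Q ^t*)) (unitarymxP uQ) (bigD1 i) //= big1 ?addr0 => [|j ji].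
  rewrite !mxE eqxx normc1 expr1n mulr1 => <-.
  by rewrite /= sqr_sqrtr // sqr_ge0.
by rewrite !mxE (negbTE (contraNneq _ ji)) 1?normc0 ?expr0n ?mulr0 // => ->.
Qed.

Lemma singular_value_perm n (A : 'M[C]_n) : exists pi : 'S_n, forall i : 'I_n,
  singular_value A i =
    Num.sqrt (complex.Re (spectral_diag (A ^t* *m A) 0 (pi i))).
Proof.
set s := fun i : 'I_n => Num.sqrt (complex.Re (spectral_diag (A ^t* *m A) 0 i)).
have := permEl (perm_sort (fun x y : R => y <= x) [seq s i | i <- enum 'I_n]).
have -> : [seq s i | i <- enum 'I_n] = [tuple s i | i < n] by [].
move/tuple_permP => [p ep]; exists p => i.
rewrite /singular_value /singular_values -/s ep.
by rewrite (nth_map i) ?size_enum_ord // tnth_mktuple nth_ord_enum.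
Qed.

Lemma singular_value_ge0 n (A : 'M[C]_n) k : 0 <= singular_value A k.
Proof.
rewrite /singular_value.
have [h|h] := ltnP k (size (singular_values A)); last by rewrite nth_default.
have := mem_nth 0 h; rewrite mem_sort => /mapP[i _ ->]; exact: sqrtr_ge0.
Qed.

Lemma size_singular_values n (A : 'M[C]_n) : size (singular_values A) = n.
Proof. by rewrite size_sort size_map size_enum_ord. Qed.

Lemma le_singular_value n (A : 'M[C]_n) i j : (i <= j)%N ->
  singular_value A j <= singular_value A i.
Proof.
move=> ij; have [h|h] := ltnP j n; last first.
  rewrite {1}/singular_value nth_default ?size_singular_values //.
  exact: singular_value_ge0.
have st : sorted (fun x y : R => y <= x) (singular_values A).
  by apply: sort_sorted => x y; apply: le_total.
apply: (sorted_leq_nth _ _ 0 st) => //; rewrite ?inE ?size_singular_values //.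
- by move=> x y z /= h1 h2; apply: le_trans h2 h1.
- exact: leq_ltn_trans h.
Qed.

Lemma singular_value_decomp n (A : 'M[C]_n) : exists2 Q : 'M[C]_n, Q \is unitarymx &
  forall u : 'rV[C]_n, fro (u *m A^T) ^+ 2 =
    \sum_(i < n) singular_value A i ^+ 2 * normc ((u *m Q) 0 i) ^+ 2.
Proof.
have [pi epi] := singular_value_perm A.
set S := spectralmx (A ^t* *m A).
have uS : S \is unitarymx by apply: spectral_unitarymx.
exists (perm_mx pi *m S)^T.
  have uP : (perm_mx pi : 'M[C]_n) \is unitarymx.
    by apply/unitarymxP; rewrite tr_perm_mx map_perm_mx -perm_mxM mulgV perm_mx1.
  by rewrite trmx_unitary; apply: mul_unitarymx.
move=> u; apply: (@complexI R).
(* Conjugation turns [A^T] into [A ^t*], so that [gram_spectral] applies to the conjugate of [u];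
   [pi] puts the eigenvalues in decreasing order. *)
rewrite -(fro_conj (u *m A^T)) map_mxM gram_spectral -/S (reindex pi); last first.
  by exists (pi^-1)%g => i _; rewrite ?permK ?permKV.
rewrite rmorph_sum; apply: eq_bigr => i _; rewrite spectral_diag_gram -epi [RHS]rmorphM.
congr (_ * (_ ^+ _)%:C); rewrite -map_mxM mxE trmx_mul tr_perm_mx mulmxA.
rewrite -[(pi^-1)%g]invgK invgK -col_permE mxE.
by rewrite normc_conj !mxE.
Qed.

(** A space of dimension above [k] contains a nonzero [u] whose first [k] coordinates in the
    singular basis vanish. The remaining ones carry singular values of index at least [k]. *)
Lemma courant_fischer_le n (A : 'M[C]_n) k p (X : 'M[C]_(p, n)) :
  (k < \rank X)%N -> exists u : 'rV[C]_n, [/\ u != 0, (u <= X)%MS &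
    fro (u *m A^T) <= singular_value A k * fro u].
Proof.
move=> lkX; have lkn : (k < n)%N by rewrite (leq_trans lkX) ?rank_leq_col.
have [Q uQ eQ] := singular_value_decomp A.
have [|u [u0 uX uD]] := @sub_kernel_neq0 _ _ _ n X (Q *m pid_mx k).
  by apply: leq_ltn_trans (mxrankM_maxr _ _) _; rewrite rank_pid_mx // ltnW.
exists u; split => //.
rewrite -(@ler_pXn2r _ 2) ?nnegrE ?mulr_ge0 ?fro_ge0 ?singular_value_ge0 //.
rewrite exprMn eQ -(fro_unitary u uQ) fro_sqr big_ord1 mulr_sumr.
apply: ler_sum => i _; have [ik|ki] := ltnP i k.
  move: uD; rewrite mulmxA => /matrixP /(_ 0 i).
  rewrite [RHS]mxE [LHS]mxE (bigD1 i) //= big1 => [|j ji].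
    rewrite [pid_mx _ _ _]mxE eqxx ik mulr1 addr0 => ->.
    by rewrite normc0 expr0n !mulr0.
  rewrite [pid_mx _ _ _]mxE (_ : (j == i :> nat) = false) ?mulr0 //.
  exact/negbTE.
rewrite ler_wpM2r ?sqr_ge0 // ler_pXn2r ?nnegrE ?singular_value_ge0 //.
exact: le_singular_value.
Qed.

(** Here the coordinates of index above [k] are made to vanish. These are [n - k - 1] conditions,
    one fewer than the dimension available, and the coordinates left have singular values of index
    at most [k]. *)
Lemma courant_fischer_ge n (A : 'M[C]_n) k p (X : 'M[C]_(p, n)) :
  (k < n)%N -> (n - k <= \rank X)%N -> exists u : 'rV[C]_n, [/\ u != 0, (u <= X)%MS &
    singular_value A k * fro u <= fro (u *m A^T)].
Proof.
move=> lkn lkX.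
have [Q uQ eQ] := singular_value_decomp A.
have [|u [u0 uX uD]] := @sub_kernel_neq0 _ _ _ n X (Q *m copid_mx k.+1).
  apply: leq_ltn_trans (mxrankM_maxr _ _) _; rewrite rank_copid_mx //.
  apply: leq_trans lkX; rewrite ltn_sub2l //.
exists u; split => //.
rewrite -(@ler_pXn2r _ 2) ?nnegrE ?mulr_ge0 ?fro_ge0 ?singular_value_ge0 //.
rewrite exprMn eQ -(fro_unitary u uQ) fro_sqr big_ord1 mulr_sumr.
apply: ler_sum => i _; have [ik|ki] := ltnP k i.
  move: uD; rewrite mulmxA => /matrixP /(_ 0 i).
  rewrite [RHS]mxE [LHS]mxE (bigD1 i) //= big1 => [|j ji].
    rewrite [copid_mx _ _ _]mxE [(- pid_mx _) _ _]mxE [pid_mx _ _ _]mxE [1%:M _ _]mxE.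
    rewrite !eqxx ltnS leqNgt ik /= subr0 mulr1 addr0 => ->.
    by rewrite normc0 expr0n !mulr0.
  rewrite [copid_mx _ _ _]mxE [(- pid_mx _) _ _]mxE [pid_mx _ _ _]mxE [1%:M _ _]mxE.
  by rewrite (negbTE ji) (_ : (j == i :> nat) = false) ?subr0 ?mulr0 //; apply/negbTE.
rewrite ler_wpM2r ?sqr_ge0 // ler_pXn2r ?nnegrE ?singular_value_ge0 //.
exact: le_singular_value.
Qed.

End SingularValues.

(** * Singular values and Schur complements *)

Section Perturbation.
Variable R : realType.
Local Notation C := R[i].

(* [singular_value A] concerns the action of [A] on columns, while row vectors
   act on the left of [T]: hence the transpose. *)
Definition opnorm l (T : 'M[C]_l) : R := singular_value T^T 0.

(** Courant-Fischer on the line spanned by [y] yields a nonzero multiple of [y], and the inequality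
    is homogeneous. *)
Lemma fro_mul_le_opnorm l (T : 'M[C]_l) (y : 'rV[C]_l) :
  fro (y *m T) <= opnorm T * fro y.
Proof.
have [->|y0] := eqVneq y 0; first by rewrite mul0mx fro0 mulr0.
have [|u [u0 uX]] := @courant_fischer_le _ _ T^T 0 _ y.
  by rewrite lt0n mxrank_eq0.
rewrite trmxK; have [a eu] := submxP uX.
rewrite eu (mx11_scalar a) mul_scalar_mx -scalemxAl !froZ mulrCA ler_pM2l //.
rewrite lt_neqAle normc_ge0 andbT; apply: contraNneq u0 => h.
rewrite eu (mx11_scalar a) mul_scalar_mx.
by rewrite (@eq0_normc _ (a 0 0)) // scale0r.
Qed.

Lemma opnorm_attained l (T : 'M[C]_l) : (0 < l)%N ->
  exists2 y : 'rV[C]_l, y != 0 & opnorm T * fro y <= fro (y *m T).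
Proof.
move=> l0; have [|u [u0 _]] := @courant_fischer_ge _ _ T^T 0 _ 1%:M l0.
  by rewrite mxrank1 leq_subr.
by rewrite trmxK; exists u.
Qed.

Lemma opnorm_ge0 l (T : 'M[C]_l) : 0 <= opnorm T.
Proof. exact: singular_value_ge0. Qed.

Lemma opnorm_le l (T : 'M[C]_l) (c : R) : (0 < l)%N ->
  (forall y : 'rV[C]_l, fro (y *m T) <= c * fro y) -> opnorm T <= c.
Proof.
move=> l0 h; have [y y0 hy] := opnorm_attained T l0.
by rewrite -(@ler_pM2r _ (fro y)) ?fro_gt0 // (le_trans hy).
Qed.

Lemma opnorm_le_fro l (T : 'M[C]_l) : (0 < l)%N -> opnorm T <= fro T.
Proof.
by move=> l0; apply: opnorm_le => // y; rewrite mulrC froM.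
Qed.

Lemma opnorm_leD l (S T : 'M[C]_l) : (0 < l)%N -> opnorm S <= opnorm T + fro (S - T).
Proof.
move=> l0; apply: opnorm_le => // y.
rewrite -{1}(subrK T S) addrC mulmxDr mulrDl; apply: le_trans (froD _ _) _.
by rewrite lerD ?fro_mul_le_opnorm // mulrC froM.
Qed.

Section Block.
Variables (k l : nat) (M U : 'M[C]_(k + l)) (a : R).
Variables (A11 : 'M[C]_k) (A12 : 'M[C]_(k, l)) (A21 : 'M[C]_(l, k)) (A22 T : 'M[C]_l).
Hypotheses (l_gt0 : (0 < l)%N) (symM : M^T = M) (uU : U \is unitarymx).
Hypothesis eA : U^T *m M *m U = block_mx A11 A12 A21 A22.
Hypotheses (A11u : A11 \in unitmx) (a_ge0 : 0 <= a).
Hypothesis eS : A22 - A21 *m invmx A11 *m A12 = a%:C *: T.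

(** [M] is symmetric rather than Hermitian, so the change of basis is the congruence
    [U^T *m M *m U]. Since [U] is unitary, it preserves the norms that enter Courant-Fischer. *)
Let fro_block (u : 'rV[C]_(k + l)) :
  fro (u *m U^T *m M^T) = fro (u *m block_mx A11 A12 A21 A22).
Proof. by rewrite symM -eA -(fro_unitary (_ *m M) uU) !mulmxA. Qed.

Let froUT (u : 'rV[C]_(k + l)) : fro (u *m U^T) = fro u.
Proof. by rewrite fro_unitary // trmx_unitary. Qed.

Let froaC (y : 'rV[C]_l) : fro (y *m (a%:C *: T)) = a * fro (y *m T).
Proof.
by rewrite -scalemxAr froZ /= expr0n addr0 sqrtr_sqr ger0_norm.
Qed.

(** The test space is the row space of [X], of dimension [l]. Multiplying [X] by the block matrix
    gives zero in the first [k] columns and the Schur complement in the others, while the identity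
    block of [X] gives [fro y <= fro (y *m X)]. *)
Lemma singular_value_le_schur : singular_value M k <= a * opnorm T.
Proof.
pose X : 'M[C]_(l, k + l) := row_mx (- (A21 *m invmx A11)) 1%:M.
have rX : \rank (X *m U^T) = l.
  rewrite mxrankMfree ?row_free_unit ?unitmx_tr ?unitarymx_unit //.
  apply/eqP; rewrite eqn_leq rank_leq_row /= -{1}(mxrank1 C l).
  have <- : X *m col_mx 0 1%:M = 1%:M by rewrite mul_row_col mulmx0 mulmx1 add0r.
  exact: mxrankM_maxl.
have [||u [u0 uX]] := @courant_fischer_ge _ _ M k _ (X *m U^T).
- by rewrite -[ltnLHS]addn0 ltn_add2l.
- by rewrite rX addKn.
have [y eu] := submxP uX; rewrite eu mulmxA froUT fro_block => h.
have y0 : 0 < fro y.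
  by apply: fro_gt0; apply: contraNneq u0 => y0; rewrite eu y0 mul0mx.
rewrite -(ler_pM2r y0); apply: le_trans (_ : fro (y *m X *m block_mx A11 A12 A21 A22) <= _).
  apply: le_trans h; rewrite ler_wpM2l ?singular_value_ge0 //.
  by rewrite /X mul_mx_row mulmx1 fro_row_mx_ler.
rewrite -mulmxA mul_row_block !mulNmx !mul1mx mulmxKV // addNr addrC eS.
rewrite mul_mx_row mulmx0; apply: le_trans (fro_row_mx_leD _ _) _.
by rewrite fro0 add0r froaC -mulrA ler_wpM2l // fro_mul_le_opnorm.
Qed.

(** The test space has dimension [k + 1]: the first [k] coordinates together with a line on which
    [T] attains its norm. A vector [(x1, x2)] of it, of norm [N], is sent to two blocks of norm at
    most [tau * N]. The first block [w] controls [x1] in terms of [x2], and the second controls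
    [x2 *m T]. *)
Lemma singular_value_ge_schur (tau := singular_value M k) :
  a * opnorm T * (1 - fro (invmx A11) * tau) <=
  tau * (1 + fro (invmx A11 *m A12)) * (1 + fro (A21 *m invmx A11)).
Proof.
have [y y0 hy] := opnorm_attained T l_gt0.
pose X : 'M[C]_(k + 1, k + l) := block_mx 1%:M 0 0 y.
have [|u [u0 uX]] := @courant_fischer_le _ _ M k _ (X *m U^T).
  rewrite mxrankMfree ?row_free_unit ?unitmx_tr ?unitarymx_unit //.
  by rewrite rank_diag_block_mx mxrank1 rank_rV y0 addn1.
have [b eu] := submxP uX; rewrite -/tau.
have [x1 [x2 [ev hx2]]] : exists x1, exists x2, b *m X = row_mx x1 x2 /\
    opnorm T * fro x2 <= fro (x2 *m T).
  exists (lsubmx b), (rsubmx b *m y); split.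
    by rewrite -{1}(hsubmxK b) mul_row_block !mulmx0 mulmx1 addr0 add0r.
  rewrite (mx11_scalar (rsubmx b)) mul_scalar_mx -scalemxAl !froZ mulrCA.
  by rewrite ler_wpM2l // normc_ge0.
rewrite eu mulmxA ev in u0 *; rewrite froUT fro_block mul_row_block => h.
set N := fro (row_mx x1 x2) in h; have N0 : 0 < N.
  by apply: fro_gt0; apply: contraNneq u0 => ->; rewrite mul0mx eqxx.
have t0 : 0 <= tau by apply: singular_value_ge0.
set w := x1 *m A11 + x2 *m A21 in h.
have ex1 : x1 = w *m invmx A11 - x2 *m (A21 *m invmx A11).
  by rewrite mulmxDl mulmxK // mulmxA addrK.
have e2 : x1 *m A12 + x2 *m A22 = w *m (invmx A11 *m A12) + x2 *m (a%:C *: T).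
  by rewrite -eS {1}ex1 mulmxBl mulmxBr !mulmxA -addrA [- _ + _]addrC.
rewrite e2 in h.
have hw : fro w <= tau * N by apply: le_trans h; apply: fro_row_mx_lel.
have h2 : fro (w *m (invmx A11 *m A12) + x2 *m (a%:C *: T)) <= tau * N.
  by apply: le_trans h; apply: fro_row_mx_ler.
have h3 : a * fro (x2 *m T) <= tau * N + fro w * fro (invmx A11 *m A12).
  rewrite -froaC -(addKr (w *m (invmx A11 *m A12)) (x2 *m _)) addrC.
  apply: le_trans (froB _ _) _; rewrite lerD //; exact: froM.
have h4 : fro x1 <= fro w * fro (invmx A11) + fro x2 * fro (A21 *m invmx A11).
  by rewrite {1}ex1; apply: le_trans (froB _ _) _; rewrite lerD // froM.
have h5 : N <= fro x1 + fro x2 by apply: fro_row_mx_leD.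
move: hw h3 h4 h5 hx2.
have := fro_ge0 (invmx A11); have := fro_ge0 (invmx A11 *m A12).
have := fro_ge0 (A21 *m invmx A11); have := fro_ge0 x2; have := opnorm_ge0 T.
move: (fro (invmx A11)) (fro (invmx A11 *m A12)) (fro (A21 *m invmx A11)).
move=> al ka be.
move: (fro w) (fro x1) (fro x2) (fro (x2 *m T)) (opnorm T) => W X1 X2 X3 om.
move=> om0 X20 be0 ka0 al0 hw h3 h4 h5 hx2.
rewrite -(ler_pM2r N0).
(* [x2] carries a definite share of the norm [N], because [x1] is bounded by [w] and [x2]. *)
have g1 : N * (1 - al * tau) <= (1 + be) * X2 by nra.
have g2 : a * om * X2 <= tau * N * (1 + ka).
  have : a * (om * X2) <= a * X3 by rewrite ler_wpM2l.
  by nra.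
have g3 : a * om * (N * (1 - al * tau)) <= a * om * ((1 + be) * X2).
  by rewrite ler_wpM2l // mulr_ge0.
have g4 : (1 + be) * (a * om * X2) <= (1 + be) * (tau * N * (1 + ka)).
  by rewrite ler_wpM2l // addr_ge0.
lra.
Qed.

End Block.
End Perturbation.

(** * Limits of matrices *)

Section FroCvg.
Variables (R : realType) (T : Type) (F : set_system T).
Context {FF : ProperFilter F}.
Local Notation C := R[i].

(** Convergence is expressed by a real function, so that limits of matrices reduce to real
    inequalities and a squeeze. *)
Definition fro_cvg p q (A : T -> 'M[C]_(p, q)) (A0 : 'M[C]_(p, q)) : Prop :=
  fro (A e - A0) @[e --> F] --> (0 : R).

Lemma fro_cvg_le p q (A : T -> 'M[C]_(p, q)) A0 (f : T -> R) :
  (\forall e \near F, fro (A e - A0) <= f e) -> f e @[e --> F] --> (0 : R) ->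
  fro_cvg A A0.
Proof.
move=> h f0; apply: (squeeze_cvgr _ (cvg_cst _) f0).
by near=> e; rewrite fro_ge0 /=; near: e.
Unshelve. all: by end_near. Qed.

Lemma fro_cvg_cst p q (A0 : 'M[C]_(p, q)) : fro_cvg (fun=> A0) A0.
Proof. by rewrite /fro_cvg subrr fro0; apply: cvg_cst. Qed.

Lemma fro_cvg_norm p q (A : T -> 'M[C]_(p, q)) A0 :
  fro_cvg A A0 -> fro (A e) @[e --> F] --> fro A0.
Proof.
move=> h.
have h0 : `|fro (A e) - fro A0| @[e --> F] --> (0 : R); last first.
  by move/norm_cvg0 : h0 => /subr_cvg0.
apply: (squeeze_cvgr _ (cvg_cst _) h); near=> e.
rewrite normr_ge0 /= ler_norml; apply/andP; split.
  rewrite lerNl opprB lerBlDl -[fro (A e - A0)]froN opprB.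
  by rewrite -{1}(subrK (A e) A0) addrC froD.
by rewrite lerBlDl -{1}(subrK A0 (A e)) addrC froD.
Unshelve. all: by end_near. Qed.

Lemma fro_cvgD p q (A B : T -> 'M[C]_(p, q)) A0 B0 :
  fro_cvg A A0 -> fro_cvg B B0 -> fro_cvg (fun e => A e + B e) (A0 + B0).
Proof.
move=> hA hB; apply: (@fro_cvg_le _ _ _ _ (fun e => fro (A e - A0) + fro (B e - B0))).
  by near=> e; rewrite opprD addrACA froD.
by rewrite -[X in _ --> X]addr0; apply: cvgD.
Unshelve. all: by end_near. Qed.

Lemma fro_cvgM p q r (A : T -> 'M[C]_(p, q)) (B : T -> 'M[C]_(q, r)) A0 B0 :
  fro_cvg A A0 -> fro_cvg B B0 -> fro_cvg (fun e => A e *m B e) (A0 *m B0).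
Proof.
move=> hA hB.
apply: (@fro_cvg_le _ _ _ _ (fun e => fro (A e) * fro (B e - B0) + fro (A e - A0) * fro B0)).
  near=> e; rewrite (_ : _ - _ = A e *m (B e - B0) + (A e - A0) *m B0).
    by apply: le_trans (froD _ _) _; rewrite lerD // froM.
  by rewrite mulmxBr mulmxBl addrA subrK.
rewrite (_ : 0 = fro A0 * 0 + 0 * fro B0 :> R); last by rewrite mulr0 mul0r addr0.
apply: cvgD; first by apply: cvgM => //; apply: fro_cvg_norm.
by apply: cvgM => //; apply: cvg_cst.
Unshelve. all: by end_near. Qed.

Lemma normc_real (x : R) : normc x%:C = `|x|.
Proof. by rewrite /= expr0n addr0 sqrtr_sqr. Qed.

Lemma fro_cvgZ p q (f : T -> R) (c : R) (A : T -> 'M[C]_(p, q)) A0 :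
  f e @[e --> F] --> c -> fro_cvg A A0 ->
  fro_cvg (fun e => (f e)%:C *: A e) (c%:C *: A0).
Proof.
move=> hf hA.
apply: (@fro_cvg_le _ _ _ _ (fun e => `|f e| * fro (A e - A0) + `|f e - c| * fro A0)).
  near=> e; rewrite (_ : _ - _ = (f e)%:C *: (A e - A0) + (f e - c)%:C *: A0).
    by apply: le_trans (froD _ _) _; rewrite !froZ !normc_real.
  by rewrite rmorphB scalerBr scalerBl addrA subrK.
rewrite (_ : 0 = `|c| * 0 + `|c - c| * fro A0 :> R); last first.
  by rewrite subrr normr0 mulr0 mul0r addr0.
apply: cvgD; first by apply: cvgM => //; apply: cvg_norm.
apply: cvgM; last exact: cvg_cst.
by apply: cvg_norm; apply: cvgB => //; apply: cvg_cst.
Unshelve. all: by end_near. Qed.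

Lemma fro_cvgN p q (A : T -> 'M[C]_(p, q)) A0 :
  fro_cvg A A0 -> fro_cvg (fun e => - A e) (- A0).
Proof.
move=> h; apply: fro_cvg_le h; near=> e.
by rewrite -opprD froN.
Unshelve. all: by end_near. Qed.

Lemma fro_cvgB p q (A B : T -> 'M[C]_(p, q)) A0 B0 :
  fro_cvg A A0 -> fro_cvg B B0 -> fro_cvg (fun e => A e - B e) (A0 - B0).
Proof. by move=> hA hB; apply: fro_cvgD hA (fro_cvgN hB). Qed.

Lemma fro_cvg_tr p q (A : T -> 'M[C]_(p, q)) A0 :
  fro_cvg A A0 -> fro_cvg (fun e => (A e)^T) A0^T.
Proof.
move=> h; apply: fro_cvg_le h; near=> e.
by rewrite -linearB fro_tr.
Unshelve. all: by end_near. Qed.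

Lemma fro_cvg_lsubmx p q r (A : T -> 'M[C]_(p, q + r)) A0 :
  fro_cvg A A0 -> fro_cvg (fun e => lsubmx (A e)) (lsubmx A0).
Proof.
move=> h; apply: fro_cvg_le h; near=> e.
by rewrite -linearB -{2}(hsubmxK (A e - A0)) fro_row_mx_lel.
Unshelve. all: by end_near. Qed.

Lemma fro_cvg_rsubmx p q r (A : T -> 'M[C]_(p, q + r)) A0 :
  fro_cvg A A0 -> fro_cvg (fun e => rsubmx (A e)) (rsubmx A0).
Proof.
move=> h; apply: fro_cvg_le h; near=> e.
by rewrite -linearB -{2}(hsubmxK (A e - A0)) fro_row_mx_ler.
Unshelve. all: by end_near. Qed.

Lemma fro_cvg_usubmx p q r (A : T -> 'M[C]_(q + r, p)) A0 :
  fro_cvg A A0 -> fro_cvg (fun e => usubmx (A e)) (usubmx A0).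
Proof.
move=> /fro_cvg_tr/fro_cvg_lsubmx/fro_cvg_tr.
by under eq_fun do rewrite trmx_lsub trmxK; rewrite trmx_lsub trmxK.
Qed.

Lemma fro_cvg_dsubmx p q r (A : T -> 'M[C]_(q + r, p)) A0 :
  fro_cvg A A0 -> fro_cvg (fun e => dsubmx (A e)) (dsubmx A0).
Proof.
move=> /fro_cvg_tr/fro_cvg_rsubmx/fro_cvg_tr.
by under eq_fun do rewrite trmx_rsub trmxK; rewrite trmx_rsub trmxK.
Qed.

Lemma fro_cvg_sum (I : finType) p q (A : I -> T -> 'M[C]_(p, q)) A0 :
  (forall i, fro_cvg (A i) (A0 i)) ->
  fro_cvg (fun e => \sum_i A i e) (\sum_i A0 i).
Proof.
move=> h; elim: (index_enum I) => [|i r IH].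
  rewrite big_nil (_ : (fun e => _) = fun=> 0); first exact: fro_cvg_cst.
  by apply/funext => e; rewrite big_nil.
rewrite big_cons (_ : (fun e => _) = fun e => A i e + \sum_(j <- r) A j e).
  exact: fro_cvgD.
by apply/funext => e; rewrite big_cons.
Qed.

(** Once [fro (A e - A0) * c < 1/2], a vector [x] with [x *m A e = 0] equals
    [- x *m (A e - A0) *m invmx A0], whose norm is at most half that of [x]; hence [A e] is
    invertible. The difference of the inverses is then given by the resolvent identity. *)
Lemma fro_cvg_inv p (A : T -> 'M[C]_p) A0 : A0 \in unitmx -> fro_cvg A A0 ->
  (\forall e \near F, A e \in unitmx) /\
  fro_cvg (fun e => invmx (A e)) (invmx A0).
Proof.
move=> uA0 hA; set c := fro (invmx A0).
have hq : fro (A e - A0) * c @[e --> F] --> (0 : R).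
  by rewrite -[X in _ --> X](mul0r c); apply: cvgM => //; apply: cvg_cst.
have nq : \forall e \near F, fro (A e - A0) * c < 2^-1.
  by apply: (cvgr_lt _ hq); rewrite invr_gt0.
have nu : \forall e \near F, A e \in unitmx.
  near=> e; have q2 : fro (A e - A0) * c < 2^-1 by near: e.
  rewrite -row_free_unit -kermx_eq0; apply: contraT; rewrite -nz_row_eq0 => nz.
  set x := nz_row _ in nz.
  have xA : x *m A e = 0 by apply/sub_kermxP/nz_row_sub.
  have ex : x = - (x *m (A e - A0) *m invmx A0).
    by rewrite mulmxBr xA add0r mulNmx opprK mulmxK.
  have := froM (x *m (A e - A0)) (invmx A0); rewrite -froN -ex => h.
  have := froM x (A e - A0) => h'.
  have : fro x <= fro x * (fro (A e - A0) * c).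
    by apply: le_trans h _; rewrite mulrA ler_wpM2r ?fro_ge0.
  have := fro_gt0 nz; nra.
split => //; apply: (@fro_cvg_le _ _ _ _ (fun e => 2 * c * (fro (A e - A0) * c))); last first.
  by rewrite -[X in _ --> X](mulr0 (2 * c)); apply: cvgM => //; apply: cvg_cst.
near=> e; have q2 : fro (A e - A0) * c < 2^-1 by near: e.
have uA : A e \in unitmx by near: e.
have e1 : invmx (A e) - invmx A0 = - (invmx (A e) *m (A e - A0) *m invmx A0).
  by rewrite mulmxBr mulVmx // mulmxBl mul1mx mulmxK // opprB.
have h1 : fro (invmx (A e) - invmx A0) <= fro (invmx (A e)) * (fro (A e - A0) * c).
  rewrite e1 froN; apply: le_trans (froM _ _) _.
  by rewrite mulrA ler_wpM2r ?fro_ge0 // froM.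
have h2 : fro (invmx (A e)) <= c + fro (invmx (A e) - invmx A0).
  by rewrite -{1}(subrK (invmx A0) (invmx (A e))) addrC froD.
have := fro_ge0 (invmx (A e)); have : 0 <= fro (A e - A0) * c by rewrite mulr_ge0 ?fro_ge0.
move: (fro _ * c) (fro (invmx (A e))) q2 h1 h2 => q X q2 h1 h2 q0 X0.
(* Together [h1] and [h2] give [X <= c + X * q] with [q < 1/2]; this is the origin of the factor
   [2 * c]. *)
have : X <= 2 * c by nra.
nra.
Unshelve. all: by end_near. Qed.

End FroCvg.

(** * Asymptotics of the singular value *)

(** Gram-Schmidt is applied to [V] padded with zero rows to a square matrix, so that the result is
    unitary and its first [k] rows span those of [V]. *)
Lemma unitary_row_reduction (C : numClosedFieldType) k l (V : 'M[C]_(k, k + l)) :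
  \rank V = k -> exists (Q : 'M[C]_(k + l)) (T : 'M[C]_k),
    [/\ Q \is unitarymx, T \in unitmx & V *m Q = row_mx T 0].
Proof.
move=> rV; set S := schmidt (col_mx V (0 : 'M[C]_(l, k + l))).
have uS : S \is unitarymx by apply: schmidt_unitarymx.
have /submxP [T eV] : (V <= usubmx S)%MS.
  apply/row_subP => i.
  have := row_schmidt_sub (col_mx V (0 : 'M[C]_(l, k + l))) (lshift l i).
  rewrite -/S rowKu => /submx_trans; apply; apply/sumsmx_subP => j ji.
  rewrite genmxE; have jk : (j < k)%N by apply: leq_ltn_trans ji _; rewrite /= ltn_ord.
  rewrite (_ : j = lshift l (Ordinal jk)); last exact: val_inj.
  by rewrite -row_usubmx row_sub.
exists (S ^t*), T; split; first by rewrite trmxC_unitary.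
  rewrite -row_full_unit -col_leq_rank -{1}rV eV; exact: mxrankM_maxl.
have e : usubmx S *m S ^t* = row_mx 1%:M 0.
  have -> : usubmx S = row_mx 1%:M 0 *m S.
    by rewrite -{2}(vsubmxK S) mul_row_col mul1mx mul0mx addr0.
  by rewrite -mulmxA (unitarymxP uS) mulmx1.
by rewrite eV -mulmxA e mul_mx_row mulmx1 mulmx0.
Qed.

Section Asymptotics.
Variables (R : realType) (k l : nat).
Local Notation C := R[i].

Variables (M : R -> 'M[C]_(k + l)) (V V1 : R -> 'M[C]_(k, k + l)) (D : 'M[C]_k).
Variables (G : R -> 'M[C]_(k + l)) (V0 V10 : 'M[C]_(k, k + l)) (G0 : 'M[C]_(k + l)).
Hypotheses (l_gt0 : (0 < l)%N) (Du : D \in unitmx) (rV0 : \rank V0 = k).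
Hypothesis symM : forall e, (M e)^T = M e.
Hypothesis eM : forall e, M e = (V e)^T *m D *m V e + (e ^+ 2)%:C *: G e.
Hypothesis eV : forall e, V e = V0 + e%:C *: V1 e.
Hypotheses (V1_cvg : fro_cvg 0^'+ V1 V10) (G_cvg : fro_cvg 0^'+ G G0).

Let id_cvg0 : (x : R) @[x --> 0^'+] --> (0 : R).
Proof. exact: cvg_at_right_filter cvg_id. Qed.

Lemma singular_value_asymptotics : exists2 Omega : R, Omega <= fro G0 &
  singular_value (M e) k / e ^+ 2 @[e --> 0^'+] --> Omega.
Proof.
have [Q [T [uQ Tu eT]]] := unitary_row_reduction rV0.
pose H e := Q^T *m G e *m Q.
have H_cvg : fro_cvg 0^'+ H (Q^T *m G0 *m Q).
  by do 2?apply: fro_cvgM => //; apply: fro_cvg_cst.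
pose Va e := T + e%:C *: lsubmx (V1 e *m Q).
pose Vb e := rsubmx (V1 e *m Q).
have V1Q_cvg : fro_cvg 0^'+ (fun e => V1 e *m Q) (V10 *m Q).
  by apply: fro_cvgM => //; apply: fro_cvg_cst.
(* In the basis [Q] the last [l] columns of [V e] vanish at [e = 0], hence the factor [e]. *)
have eVQ e : V e *m Q = row_mx (Va e) (e%:C *: Vb e).
  rewrite eV mulmxDl eT -scalemxAl -{1}(hsubmxK (V1 e *m Q)) scale_row_mx.
  by rewrite add_row_mx add0r.
have Va_cvg : fro_cvg 0^'+ Va T.
  rewrite -[X in fro_cvg _ _ X]addr0 -(scale0r (lsubmx (V10 *m Q))).
  apply: fro_cvgD; first exact: fro_cvg_cst.
  by apply: (@fro_cvgZ _ _ _ _ _ _ _ 0) => //; apply: fro_cvg_lsubmx.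
pose Vb0 := rsubmx (V10 *m Q).
have Vb_cvg : fro_cvg 0^'+ Vb Vb0 by apply: fro_cvg_rsubmx.
pose A11 e := (Va e)^T *m D *m Va e + (e ^+ 2)%:C *: ulsubmx (H e).
pose B12 e := (Va e)^T *m D *m Vb e + e%:C *: ursubmx (H e).
pose B21 e := (Vb e)^T *m D *m Va e + e%:C *: dlsubmx (H e).
pose B22 e := (Vb e)^T *m D *m Vb e + drsubmx (H e).
have eA e : Q^T *m M e *m Q = block_mx (A11 e) (e%:C *: B12 e) (e%:C *: B21 e)
    ((e ^+ 2)%:C *: B22 e).
  rewrite eM mulmxDr mulmxDl -scalemxAr -scalemxAl -/(H e).
  rewrite (_ : Q^T *m _ *m Q = (V e *m Q)^T *m D *m (V e *m Q)); last first.
    by rewrite trmx_mul !mulmxA.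
  rewrite eVQ tr_row_mx mul_col_mx mul_col_row -{1}(submxK (H e)) scale_block_mx.
  rewrite add_block_mx /A11 /B12 /B21 /B22 !scalerDr !scalerA !linearZ /=.
  by rewrite -!scalemxAl !scalerA -!rmorphM -!expr2.
have sq_cvg0 : (x ^+ 2 : R) @[x --> 0^'+] --> (0 : R).
  by rewrite -[X in _ --> X](mulr0 0); under eq_fun do rewrite expr2; apply: cvgM.
pose K := T^T *m D *m T.
have Ku : K \in unitmx by rewrite !unitmx_mul unitmx_tr Tu Du.
have A11_cvg : fro_cvg 0^'+ A11 K.
  rewrite -[X in fro_cvg _ _ X]addr0 -(scale0r (ulsubmx (Q^T *m G0 *m Q))).
  apply: fro_cvgD.
    apply: fro_cvgM => //.
    by apply: fro_cvgM; [exact: fro_cvg_tr|exact: fro_cvg_cst].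
  apply: (@fro_cvgZ _ _ _ _ _ _ _ 0) => //.
  by apply: fro_cvg_lsubmx; apply: fro_cvg_usubmx.
have B12_cvg : fro_cvg 0^'+ B12 (T^T *m D *m Vb0).
  rewrite -[X in fro_cvg _ _ X]addr0 -(scale0r (ursubmx (Q^T *m G0 *m Q))).
  apply: fro_cvgD.
    apply: fro_cvgM => //.
    by apply: fro_cvgM; [exact: fro_cvg_tr|exact: fro_cvg_cst].
  by apply: (@fro_cvgZ _ _ _ _ _ _ _ 0) => //; apply: fro_cvg_rsubmx; apply: fro_cvg_usubmx.
have B21_cvg : fro_cvg 0^'+ B21 (Vb0^T *m D *m T).
  rewrite -[X in fro_cvg _ _ X]addr0 -(scale0r (dlsubmx (Q^T *m G0 *m Q))).
  apply: fro_cvgD.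
    apply: fro_cvgM => //.
    by apply: fro_cvgM; [exact: fro_cvg_tr|exact: fro_cvg_cst].
  by apply: (@fro_cvgZ _ _ _ _ _ _ _ 0) => //; apply: fro_cvg_lsubmx; apply: fro_cvg_dsubmx.
have B22_cvg : fro_cvg 0^'+ B22 (Vb0^T *m D *m Vb0 + drsubmx (Q^T *m G0 *m Q)).
  apply: fro_cvgD; last by apply: fro_cvg_rsubmx; apply: fro_cvg_dsubmx.
  apply: fro_cvgM => //.
    by apply: fro_cvgM; [exact: fro_cvg_tr|exact: fro_cvg_cst].
have [A11u iA11_cvg] := fro_cvg_inv Ku A11_cvg.
(* The two factors [e] of the off-diagonal blocks combine to [e ^+ 2], which therefore factors out
   of the whole Schur complement. *)
pose S e := B22 e - B21 e *m invmx (A11 e) *m B12 e.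
pose S0 := drsubmx (Q^T *m G0 *m Q).
have S_cvg : fro_cvg 0^'+ S S0.
  (* Since [K = T^T *m D *m T], the contributions of [Vb0] cancel in the limit, and only the block
     coming from [G0] survives. *)
  have -> : S0 = Vb0^T *m D *m Vb0 + drsubmx (Q^T *m G0 *m Q) -
      Vb0^T *m D *m T *m invmx K *m (T^T *m D *m Vb0).
    rewrite -/S0 (_ : _ *m (T^T *m D *m Vb0) = Vb0^T *m D *m Vb0).
      by rewrite addrAC subrr add0r.
    have TDu : T^T *m D \in unitmx by rewrite unitmx_mul unitmx_tr Tu Du.
    have iK : T *m invmx K *m (T^T *m D) = 1%:M.
      apply: (can_inj (mulKmx TDu)); rewrite mulmx1 !mulmxA.
      by rewrite -(mulmxA _ _ (invmx K)) !mulmxA mulmxV // mul1mx.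
    have {}iK : T *m (invmx K *m (T^T *m (D *m Vb0))) = Vb0.
      by rewrite (mulmxA T^T) mulmxA mulmxA iK mul1mx.
    by rewrite -!mulmxA iK.
  by apply: fro_cvgB => //; do 2?apply: fro_cvgM.
pose om e := opnorm (S e).
pose al e := fro (invmx (A11 e)).
pose ka e := fro (invmx (A11 e) *m (e%:C *: B12 e)).
pose be e := fro ((e%:C *: B21 e) *m invmx (A11 e)).
have om_cvg : om e @[e --> 0^'+] --> opnorm S0.
  have h0 : `|om e - opnorm S0| @[e --> 0^'+] --> (0 : R); last first.
    by move/norm_cvg0 : h0 => /subr_cvg0.
  apply: (squeeze_cvgr _ (cvg_cst _) S_cvg); near=> e.
  rewrite normr_ge0 /= ler_norml; apply/andP; split.
    by rewrite lerNl opprB lerBlDl -froN opprB opnorm_leD.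
  by rewrite lerBlDl opnorm_leD.
have al_cvg : al e @[e --> 0^'+] --> fro (invmx K) by apply: fro_cvg_norm.
have ka_cvg : ka e @[e --> 0^'+] --> (0 : R).
  rewrite -[X in _ --> X](fro0 R k l) -(mulmx0 l (invmx K)) -(scale0r (T^T *m D *m Vb0)).
  by apply: fro_cvg_norm; apply: fro_cvgM => //; apply: (@fro_cvgZ _ _ _ _ _ _ _ 0).
have be_cvg : be e @[e --> 0^'+] --> (0 : R).
  rewrite -[X in _ --> X](fro0 R l k) -(mul0mx l (invmx K)) -(scale0r (Vb0^T *m D *m T)).
  by apply: fro_cvg_norm; apply: fro_cvgM => //; apply: (@fro_cvgZ _ _ _ _ _ _ _ 0).
exists (opnorm S0).
  (* Multiplication by [Q^T] and [Q] preserves the Frobenius norm, and a block has at most the norm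
     of the whole matrix. *)
  apply: le_trans (opnorm_le_fro _ l_gt0) _.
  have -> : fro G0 = fro (Q^T *m G0 *m Q).
    by rewrite fro_unitary // -[RHS]fro_tr trmx_mul trmxK fro_unitary ?fro_tr.
  rewrite /S0 -{2}(submxK (Q^T *m G0 *m Q)) block_mxEh -fro_tr.
  apply: le_trans _ (fro_row_mx_ler _ _); rewrite -[leRHS]fro_tr tr_col_mx.
  exact: fro_row_mx_ler.
(* In the lower bound, the singular value inside the factor [1 - al * tau] is replaced by its upper
   bound [e ^+ 2 * om e], so that both sides of the squeeze have explicit limits. *)
apply: (@squeeze_cvgr _ _ _ _
    (fun e => om e * (1 - al e * (e ^+ 2 * om e)) / ((1 + ka e) * (1 + be e))) om);
  last exact: om_cvg; last first.
  rewrite (_ : opnorm S0 = opnorm S0 * (1 - fro (invmx K) * (0 * opnorm S0)) /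
      ((1 + 0) * (1 + 0))); last by rewrite mul0r mulr0 subr0 addr0 !mulr1 invr1 mulr1.
  apply: cvgM; first (apply: cvgM => //; apply: cvgB; first exact: cvg_cst).
    by apply: cvgM => //; apply: cvgM.
  apply: cvgV; first by rewrite addr0 mulr1 oner_neq0.
  by apply: cvgM; apply: cvgD => //; apply: cvg_cst.
near=> e.
have e0 : 0 < e by near: e; exact: nbhs_right_gt.
have e20 : 0 < e ^+ 2 by rewrite exprn_gt0.
have uA : A11 e \in unitmx by near: e.
have eS : (e ^+ 2)%:C *: B22 e - e%:C *: B21 e *m invmx (A11 e) *m (e%:C *: B12 e) =
    (e ^+ 2)%:C *: S e.
  by rewrite -scalemxAr -!scalemxAl scalerA -rmorphM -expr2 -scalerBr.
have up := singular_value_le_schur l_gt0 (symM e) uQ (eA e) uA (ltW e20) eS.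
have lo := singular_value_ge_schur l_gt0 (symM e) uQ (eA e) uA (ltW e20) eS.
have up' : singular_value (M e) k / e ^+ 2 <= om e by rewrite ler_pdivrMr // mulrC.
rewrite up' andbT.
have k0 : 0 <= ka e by apply: fro_ge0.
have b0 : 0 <= be e by apply: fro_ge0.
rewrite ler_pdivrMr; last by rewrite mulr_gt0 // ltr_wpDr.
rewrite -(ler_pM2l e20).
have -> : e ^+ 2 * (singular_value (M e) k / e ^+ 2 * ((1 + ka e) * (1 + be e))) =
    singular_value (M e) k * (1 + ka e) * (1 + be e).
  by field; rewrite gt_eqF.
apply: le_trans lo; rewrite -/(om e) -/(al e) mulrA ler_wpM2l //.
  by rewrite mulr_ge0 ?opnorm_ge0 // ltW.
by rewrite lerD2l lerN2 ler_wpM2l // fro_ge0.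
Unshelve. all: by end_near. Qed.

End Asymptotics.

(** * Expansion of the matrix of traces *)

Section Expansion.
Variables (R : realType) (m : nat).
Local Notation C := R[i].

Definition dir_deriv (x d : 'rV[C]_m) (p : {mpoly C[m]}) : C :=
  \sum_r eval_at x p^`M(r) * d 0 r.

Lemma eval_atD (x : 'rV[C]_m) (p q : {mpoly C[m]}) :
  eval_at x (p + q) = eval_at x p + eval_at x q.
Proof. exact: mevalD. Qed.

Lemma eval_atM (x : 'rV[C]_m) (p q : {mpoly C[m]}) :
  eval_at x (p * q) = eval_at x p * eval_at x q.
Proof. exact: mevalM. Qed.

(** The property holds for constants and variables and is stable under sums and products, hence
    holds for all polynomials. A polynomial remainder is bounded near 0. *)
Lemma eval_at_line (x d : 'rV[C]_m) (p : {mpoly C[m]}) :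
  exists r : {poly C}, forall e : C, eval_at (x + e *: d) p =
    eval_at x p + e * dir_deriv x d p + e ^+ 2 * r.[e].
Proof.
pose L (p : {mpoly C[m]}) := exists r : {poly C}, forall e : C,
  eval_at (x + e *: d) p = eval_at x p + e * dir_deriv x d p + e ^+ 2 * r.[e].
have LC c : L c%:MP.
  exists 0 => e; rewrite /dir_deriv /eval_at !mevalC horner0 mulr0 addr0.
  by rewrite big1 ?mulr0 ?addr0 // => r _; rewrite mderivC meval0 mul0r.
have LX i : L 'X_i.
  exists 0 => e; rewrite /dir_deriv /eval_at !mevalXU horner0 mulr0 addr0 !mxE.
  rewrite (bigD1 i) //= big1 ?addr0 => [|j ji].
    rewrite mderivX mnm1E eqxx scale1r (_ : U_(i) - U_(i) = 0)%MM ?mpolyX0 ?meval1 ?mul1r //.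
    by apply/mnmP => j; rewrite mnmBE subnn mnm0E.
  by rewrite mderivX mnm1E eq_sym (negbTE ji) scale0r meval0 mul0r.
have LD p1 p2 : L p1 -> L p2 -> L (p1 + p2).
  move=> [r1 h1] [r2 h2]; exists (r1 + r2) => e.
  have -> : dir_deriv x d (p1 + p2) = dir_deriv x d p1 + dir_deriv x d p2.
    rewrite /dir_deriv -big_split; apply: eq_bigr => r _.
    by rewrite mderivD eval_atD mulrDl.
  rewrite !eval_atD h1 h2 hornerD.
  move: (eval_at _ _) (eval_at _ _) (dir_deriv _ _ _) (dir_deriv _ _ _) r1.[e] r2.[e].
  by move=> a1 a2 b1 b2 c1 c2; ring.
have LM p1 p2 : L p1 -> L p2 -> L (p1 * p2).
  move=> [r1 h1] [r2 h2].
  (* The witness collects the terms of order at least two in the product of the two expansions,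
     divided by [e ^+ 2]. *)
  exists ((dir_deriv x d p1 * dir_deriv x d p2)%:P
    + eval_at x p1 *: r2 + eval_at x p2 *: r1
    + 'X * (dir_deriv x d p1 *: r2 + dir_deriv x d p2 *: r1) + 'X^2 * r1 * r2) => e.
  have -> : dir_deriv x d (p1 * p2) =
      dir_deriv x d p1 * eval_at x p2 + eval_at x p1 * dir_deriv x d p2.
    rewrite /dir_deriv mulr_suml mulr_sumr -big_split.
    apply: eq_bigr => r _; rewrite mderivM eval_atD !eval_atM mulrDl mulrA.
    by rewrite mulrAC.
  rewrite !eval_atM h1 h2 !hornerE /=.
  move: (eval_at _ _) (eval_at _ _) (dir_deriv _ _ _) (dir_deriv _ _ _) r1.[e] r2.[e].
  by move=> a1 a2 b1 b2 c1 c2; ring.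
have LXm (mn : 'X_{1..m}) : L 'X_[mn].
  rewrite mpolyXE_id; elim/big_ind: _ => //; first exact: (LC 1).
  move=> i _; elim: (mn i) => [|a IH]; first by rewrite expr0; apply: (LC 1).
  by rewrite exprS; exact: (LM _ _ (LX i) IH).
elim/mpolyind: p => [|c mn p _ _ IH]; first by rewrite -mpolyC0; apply: LC.
rewrite -mul_mpolyC; exact: (LD _ _ (LM _ _ (LC c) (LXm mn)) IH).
Qed.

Lemma normc_horner_le (r : {poly C}) (e : R) : 0 <= e -> e <= 1 ->
  normc r.[e%:C] <= \sum_(i < size r) normc r`_i.
Proof.
move=> e0 e1; rewrite horner_coef; apply: le_trans (normc_sum _) _.
apply: ler_sum => i _; rewrite normcM -rmorphXn normc_real ger0_norm ?exprn_ge0 //.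
by rewrite ler_piMr ?normc_ge0 // exprn_ile1.
Qed.

Lemma normc_dir_deriv_le (x d : 'rV[C]_m) (p : {mpoly C[m]}) (b : R) :
  (forall r, normc (d 0 r) <= 1) -> (forall r, normc (eval_at x p^`M(r)) <= b) ->
  normc (dir_deriv x d p) <= m%:R * b.
Proof.
move=> hd hb; apply: le_trans (normc_sum _) _.
rewrite -[X in X%:R](card_ord m) mulr_natl -sumr_const.
apply: ler_sum => r _; rewrite normcM -[leRHS]mulr1.
by rewrite ler_pM ?normc_ge0.
Qed.

End Expansion.

(** * Cluster means and scatter within the clusters *)

Section TraceMatrix.
Variables (R : realType) (m n k : nat).
Local Notation C := R[i].
Variables (B : 'I_n -> {mpoly C[m]}) (z : 'I_k -> 'rV[C]_m) (ns : 'I_k -> nat).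
Variable delta : forall s : 'I_k, 'I_(ns s) -> 'rV[C]_m.

Definition center_mx : 'M[C]_(k, n) := \matrix_(s, j) eval_at (z s) (B j).

Definition quotient_poly (s : 'I_k) (t : 'I_(ns s)) (j : 'I_n) : {poly C} :=
  sval (cid (eval_at_line (z s) (delta t) (B j))).

Definition slope_mx0 (s : 'I_k) : 'M[C]_(ns s, n) :=
  \matrix_(t, j) dir_deriv (z s) (delta t) (B j).

(** This is the difference quotient of each [B j] along [delta t], extended to [e = 0] by the
    directional derivative. *)
Definition slope_mx (s : 'I_k) (e : R) : 'M[C]_(ns s, n) :=
  slope_mx0 s + e%:C *: \matrix_(t, j) (quotient_poly t j).[e%:C].

Lemma eval_at_slope (s : 'I_k) (t : 'I_(ns s)) (j : 'I_n) (e : R) :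
  eval_at (z s + e%:C *: delta t) (B j) = center_mx s j + e%:C * slope_mx s e t j.
Proof.
rewrite (svalP (cid (eval_at_line (z s) (delta t) (B j)))) !mxE /quotient_poly.
ring.
Qed.

Definition avg_row (s : 'I_k) (Y : 'M[C]_(ns s, n)) : 'rV[C]_n :=
  const_mx (ns s)%:R^-1 *m Y.

Definition centered_mx (s : 'I_k) (Y : 'M[C]_(ns s, n)) : 'M[C]_(ns s, n) :=
  Y - const_mx 1 *m avg_row Y.

(** Row [s] is the mean slope of cluster [s]. The form as a sum of products lets convergence follow
    from [fro_cvg_sum] and [fro_cvgM]. *)
Definition avg_slope_mx (Y : forall s, 'M[C]_(ns s, n)) : 'M[C]_(k, n) :=
  \sum_s delta_mx s ord0 *m avg_row (Y s).

(** The transposes are plain, without conjugation, as the traces are bilinear in the values of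
    [B]. *)
Definition scatter_mx (Y : forall s, 'M[C]_(ns s, n)) : 'M[C]_n :=
  \sum_s (centered_mx (Y s))^T *m centered_mx (Y s).

Definition size_mx : 'M[C]_k := diag_mx (\row_s (ns s)%:R).

Lemma avg_slope_mxE Y s j : avg_slope_mx Y s j = avg_row (Y s) 0 j.
Proof.
rewrite summxE (bigD1 s) //= big1 ?addr0 => [|s' ss'].
  by rewrite mxE big_ord1 mxE !eqxx mul1r.
by rewrite mxE big_ord1 mxE eq_sym (negbTE ss') mul0r.
Qed.

Lemma centered_mxE s (Y : 'M[C]_(ns s, n)) t j :
  centered_mx Y t j = Y t j - avg_row Y 0 j.
Proof. by rewrite /centered_mx mxE [in LHS]mxE [in LHS]mxE big_ord1 mxE mul1r. Qed.

(* This includes empty clusters, where [avg_row] divides by 0. *)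
Lemma sum_centered_mx s (Y : 'M[C]_(ns s, n)) j : \sum_t centered_mx Y t j = 0.
Proof.
under eq_bigr => t _ do rewrite centered_mxE.
rewrite sumrB sumr_const card_ord /avg_row mxE.
under [X in _ - X *+ _]eq_bigr => t _ do rewrite mxE.
rewrite -mulr_sumr -[X in _ - X]mulr_natl; have [n0|n0] := posnP (ns s).
  by rewrite big1 ?mulr0 ?subr0 // => -[t ht]; exfalso; rewrite n0 in ht.
by rewrite mulVKf ?subrr // pnatr_eq0 -lt0n.
Qed.

(** In cluster [s] each value is the mean [V s j] plus [e] times a centred slope. The cross terms
    vanish upon summation because the centred slopes sum to 0, so the identity is exact. *)
Lemma trace_mxE (e : R) (Y := fun s => slope_mx s e)
    (V := center_mx + e%:C *: avg_slope_mx Y) :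
  trace_mx B z delta e = V^T *m size_mx *m V + (e ^+ 2)%:C *: scatter_mx Y.
Proof.
apply/matrixP => i j; rewrite [LHS]mxE [RHS]mxE mul_mx_diag mxE.
rewrite [(_ *: scatter_mx Y) i j]mxE summxE mulr_sumr -big_split.
apply: eq_bigr => s _ /=.
have eVE t j' : eval_at (z s + e%:C *: delta t) (B j') =
    V s j' + e%:C * centered_mx (Y s) t j'.
  rewrite eval_at_slope -/(Y s) [V _ _]mxE [(_ *: avg_slope_mx Y) _ _]mxE.
  by rewrite avg_slope_mxE centered_mxE; ring.
transitivity (\sum_t (V s i * V s j + (e%:C * V s i) * centered_mx (Y s) t j
   + (e%:C * V s j) * centered_mx (Y s) t i
   + (e ^+ 2)%:C * (centered_mx (Y s) t i * centered_mx (Y s) t j))).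
  apply: eq_bigr => t _; rewrite eval_atM !eVE rmorphXn /=.
  ring.
rewrite !big_split /= -!mulr_sumr !sum_centered_mx !mulr0 !addr0.
rewrite sumr_const card_ord; congr (_ + _).
  by rewrite !mxE -mulr_natl; ring.
by congr (_ * _); rewrite mxE; apply: eq_bigr => t _; rewrite [in RHS]mxE.
Qed.

Lemma trace_mx_sym (e : R) : (trace_mx B z delta e)^T = trace_mx B z delta e.
Proof.
apply/matrixP => i j; rewrite !mxE; apply: eq_bigr => s _; apply: eq_bigr => t _.
by rewrite mulrC.
Qed.

Lemma slope_mx_cvg s : fro_cvg 0^'+ (slope_mx s) (slope_mx0 s).
Proof.
(* [K] bounds the remainders entrywise for all [e] in [[0, 1]]. *)
pose K : 'M[C]_(ns s, n) := \matrix_(t, j)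
  (\sum_(i < size (quotient_poly t j)) normc (quotient_poly t j)`_i)%:C.
apply: (@fro_cvg_le _ _ _ _ _ _ _ _ (fun e => e * fro K)); last first.
  rewrite -[X in _ --> X](mul0r (fro K)); apply: cvgM; last exact: cvg_cst.
  exact: cvg_at_right_filter cvg_id.
near=> e; have e0 : 0 < e by near: e; exact: nbhs_right_gt.
have e1 : e <= 1 by near: e; apply: nbhs_right_le.
rewrite /slope_mx addrC addKr froZ normc_real gtr0_norm // ler_pM2l //.
apply: fro_le; apply: ler_sum => t _; apply: ler_sum => j _.
rewrite ler_pXn2r ?nnegrE ?normc_ge0 // !mxE normc_real ger0_norm.
  by apply: normc_horner_le => //; apply: ltW.
by apply: sumr_ge0 => i _; apply: normc_ge0.
Unshelve. all: by end_near. Qed.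

Lemma avg_slope_mx_cvg :
  fro_cvg 0^'+ (fun e => avg_slope_mx (fun s => slope_mx s e)) (avg_slope_mx slope_mx0).
Proof.
apply: fro_cvg_sum => s; apply: fro_cvgM; first exact: fro_cvg_cst.
by apply: fro_cvgM; [exact: fro_cvg_cst | exact: slope_mx_cvg].
Qed.

Lemma scatter_mx_cvg :
  fro_cvg 0^'+ (fun e => scatter_mx (fun s => slope_mx s e)) (scatter_mx slope_mx0).
Proof.
have h s : fro_cvg 0^'+ (fun e => centered_mx (slope_mx s e)) (centered_mx (slope_mx0 s)).
  apply: fro_cvgB; first exact: slope_mx_cvg.
  apply: fro_cvgM; first exact: fro_cvg_cst.
  by apply: fro_cvgM; [exact: fro_cvg_cst | exact: slope_mx_cvg].
by apply: fro_cvg_sum => s; apply: fro_cvgM => //; apply: fro_cvg_tr.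
Qed.

(** At [e = 0] the matrix of traces is [V^T D V] with [V] of [k] rows and [D] of size [k], so rank
    [k] forces both factors to have full rank. In particular no cluster is empty. *)
Lemma rank_trace_mx0 (P : 'M[C]_n) : \rank (P *m trace_mx B z delta 0) = k ->
  \rank center_mx = k /\ size_mx \in unitmx.
Proof.
rewrite trace_mxE expr0n !scale0r !addr0 => rk.
have h : (k <= \rank (size_mx *m center_mx))%N.
  rewrite -{1}rk; apply: leq_trans (mxrankM_maxr _ _) _.
  by rewrite -mulmxA mxrankM_maxr.
split.
  apply/eqP; rewrite eqn_leq rank_leq_row /=.
  exact: leq_trans h (mxrankM_maxr _ _).
by rewrite -row_full_unit -col_leq_rank (leq_trans h) // mxrankM_maxl.
Qed.

(** A centred slope is a slope minus a mean of slopes, hence at most [2 * b] in modulus; cluster [s]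
    contributes [ns s * n] such entries. *)
Lemma fro_scatter_mx_le (b : R) :
  (forall s (t : 'I_(ns s)) j, normc (slope_mx0 s t j) <= b) ->
  fro (scatter_mx slope_mx0) <= ((\sum_s ns s) * n)%:R * (4 * b ^+ 2).
Proof.
move=> hb; apply: le_trans (fro_sum _) _.
rewrite big_distrl natr_sum mulr_suml; apply: ler_sum => s _.
apply: le_trans (froM _ _) _; rewrite fro_tr -expr2 fro_sqr.
rewrite natrM -mulrA -[X in X%:R * _](card_ord (ns s)) [leRHS]mulr_natl -sumr_const.
apply: ler_sum => t _.
rewrite -[X in X%:R * _](card_ord n) mulr_natl -sumr_const.
apply: ler_sum => j _; rewrite (_ : 4 * b ^+ 2 = (b + b) ^+ 2); last by ring.
have b0 : 0 <= b := le_trans (normc_ge0 _) (hb s t j).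
rewrite ler_pXn2r ?nnegrE ?addr_ge0 ?normc_ge0 // centered_mxE.
apply: le_trans (le_normcD _ _) _; rewrite normcN lerD // /avg_row mxE.
apply: le_trans (normc_sum _) _.
have n0 : (0 < ns s)%N by apply: leq_ltn_trans (ltn_ord t).
apply: (@le_trans _ _ (\sum_(t' < ns s) (ns s)%:R^-1 * b)).
  apply: ler_sum => t' _; rewrite normcM mxE ler_pM ?normc_ge0 //.
  rewrite (_ : _^-1 = ((ns s)%:R^-1 : R)%:C); last by rewrite fmorphV rmorph_nat.
  by rewrite normc_real ger0_norm // invr_ge0.
by rewrite sumr_const card_ord -[leLHS]mulr_natl mulVKf // pnatr_eq0 -lt0n.
Qed.

End TraceMatrix.

(** * The explicit constant and the theorem *)

Lemma bound_le (R : realType) (k l m : nat) (b : R) : (0 < l)%N ->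
  ((k + l) * (k + l))%:R * (4 * (m%:R * b) ^+ 2) <=
  4 * ((k + l)%:R - k%:R) ^+ 2 * (k%:R + 1) ^+ 2 * m%:R ^+ 2
    * Num.sqrt ((2 * (k + l)%:R + 2 * (k + l)%:R * k%:R - k%:R ^+ 2 - k%:R) / 2)
    * b ^+ 2 :> R.
Proof.
move=> l0; have k0 : 0 <= k%:R :> R by apply: ler0n.
have l1 : 1 <= l%:R :> R by rewrite ler1n.
have -> : (k + l)%:R - k%:R = l%:R :> R by rewrite natrD addrC addKr.
rewrite natrM natrD.
set x := k%:R in k0 *; set y := l%:R in l1 *.
set S := Num.sqrt _.
(* The radicand equals [y + x * y + (x ^+ 2 + x) / 2], which is at least [y]. *)
have S1 : 1 <= S.
  rewrite -[leLHS]sqrtr1 ler_wsqrtr //; nra.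
have h : (x + y) * (x + y) <= y ^+ 2 * (x + 1) ^+ 2.
  have h1 : x + y <= y * (x + 1) by nra.
  by rewrite -exprMn -expr2 ler_pXn2r ?nnegrE //; nra.
have hS : y ^+ 2 * (x + 1) ^+ 2 <= y ^+ 2 * (x + 1) ^+ 2 * S.
  by rewrite ler_peMr // mulr_ge0 ?sqr_ge0.
have := ler_wpM2r (sqr_ge0 (m%:R * b)) (le_trans h hS).
rewrite exprMn; move: (m%:R ^+ 2) (b ^+ 2) => u v; lra.
Qed.

Theorem proposition6p1 (R : realType) (m n k : nat)
    (B : 'I_n -> {mpoly R[i][m]}) (z : 'I_k -> 'rV[R[i]]_m) (ns : 'I_k -> nat)
    (delta : forall s : 'I_k, 'I_(ns s) -> 'rV[R[i]]_m)
    (P : 'M[R[i]]_n) (b' : R)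
    (hns : (\sum_(s < k) ns s)%N = n)
    (hdelta : forall (s : 'I_k) (t : 'I_(ns s)) (r : 'I_m),
       `|delta s t 0 r| < 1)
    (hP : gecp_perms (trace_mx B z delta) k P 1%:M)
    (hrank : \rank (P *m trace_mx B z delta 0) = k)
    (hreg : regular_mx (P *m trace_mx B z delta 0))
    (hb' : forall (l : 'I_n) (s : 'I_k) (r : 'I_m),
       `|eval_at (z s) ((B l)^`M(r))| <= b'%:C) :
  exists Omega : R,
    ((fun eps : R => singular_value (trace_mx B z delta eps) k
                     - Omega * eps ^+ 2 : R^o)
       =o_ (0^'+) (fun eps : R => eps ^+ 2 : R^o)) /\
    Omega <= 4 * (n%:R - k%:R) ^+ 2 * (k%:R + 1) ^+ 2 * m%:R ^+ 2
             * Num.sqrt ((2 * n%:R + 2 * n%:R * k%:R - k%:R ^+ 2 - k%:R) / 2)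
             * b' ^+ 2.
Proof.
have [rV Du] := rank_trace_mx0 hrank.
have kn : (k <= n)%N by rewrite -rV rank_leq_col.
move: kn => /subnKC; move: (n - k)%N => l en.
(* Replacing [n] by [k + l] gives the matrices the type that block decompositions require. *)
move: P B hns hP hrank hreg hb' rV; case: _ / en => P B hns _ hrank _ hb' rV.
(* If [l = 0], the index [k] is past the last singular value, the default value 0 is read, and
   [Omega = 0] works. *)
have [l0|l0] := posnP l.
  exists 0; split.
    apply/eqoP => eps eps0; near=> e.
    rewrite /singular_value nth_default ?size_singular_values; last by rewrite l0 addn0.
    by rewrite mul0r subr0 normr0 mulr_ge0 // ltW.
  do 4 (apply: mulr_ge0; last by rewrite ?sqr_ge0 ?sqrtr_ge0).
  by rewrite mulr_ge0 ?sqr_ge0 ?ler0n.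
have [Om hOm cOm] := singular_value_asymptotics l0 Du rV (trace_mx_sym B z delta)
  (trace_mxE B z delta) (fun=> erefl) (avg_slope_mx_cvg B z delta)
  (scatter_mx_cvg B z delta).
exists Om; split.
  (* The little-o statement is the limit of the quotient, multiplied by [e ^+ 2]. *)
  apply/eqoP => eps eps0; near=> e.
  have e20 : 0 < e ^+ 2 by rewrite exprn_gt0 //; near: e; exact: nbhs_right_gt.
  have h : `|Om - singular_value (trace_mx B z delta e) k / e ^+ 2| <= eps.
    by near: e; apply: (cvgrPdist_le _ _).1 cOm _ eps0.
  rewrite (gtr0_norm e20) distrC (_ : _ - _ =
     (Om - singular_value (trace_mx B z delta e) k / e ^+ 2) * e ^+ 2).
    by rewrite normrM (gtr0_norm e20) ler_pM2r.
  by field; rewrite gt_eqF.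
apply: le_trans hOm _.
(* The absolute value covers [m = 0], where [hb'] says nothing about the sign of [b']; only the
   square enters the final bound. *)
have bound : forall s (t : 'I_(ns s)) j,
    normc (slope_mx0 B z delta s t j) <= m%:R * `|b'|.
  move=> s t j; rewrite mxE; apply: normc_dir_deriv_le => r.
    by rewrite -lecR -normr_normc ltW // hdelta.
  apply: le_trans (ler_norm b'); rewrite -lecR; exact: hb'.
apply: le_trans (fro_scatter_mx_le bound) _.
rewrite hns -[X in _ <= _ * X]real_normK ?num_real //; exact: bound_le.
Unshelve. all: by end_near. Qed.
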